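(* (a) Let $f:X\to Y$ be a perfect map between zero-dimensional locally compact Hausdorff spaces, let $A=CO(X)$, $B=CO(Y)$ and let $\varphi=\Theta^t(f):B\to A$ be given by $\varphi(G)=f^{-1}(G)$. Then the map $f$ is open iff $\varphi:B\to A$ has a lower adjoint $\psi:A\to B$. (b) The category $\mathbf{OPZLC}$ of all zero-dimensional locally compact Hausdorff spaces and all open perfect maps is dually equivalent to the category $\mathbf{OPZLBA}$ whose objects are all ZLB-algebras and whose morphisms are all $\mathbf{ZLBA}$-morphisms $\varphi:(A,I)\to(B,J)$ such that $\varphi(I)\subseteq J$ and $\varphi:A\to B$ has a lower adjoint.
   Context: A space is zero-dimensional if its clopen subsets form a base. $CO(X)$ is the Boolean algebra of clopen subsets of $X$. A perfect map is a continuous closed map with compact fibres. A lower adjoint of an order-preserving map $\varphi:P\to Q$ between posets is an order-preserving map $\psi:Q\to P$ such that for all $p\in P$, $q\in Q$: $q\le\varphi(p)$ iff $\psi(q)\le p$. For a distributive $\{0\}$-pseudolattice $I$ (a poset with least element $0$ and all finite non-empty meets and joins, distributive), $Idl(I)$ is the frame of all ideals of $I$; for $J\in Idl(I)$, $\neg J=\{a\in I : a\wedge b=0\ \text{for all } b\in J\}$. The ideal $J$ is simple if $J\vee\neg J=I$ in $Idl(I)$; $Si(I)$ is the set of simple ideals. A local Boolean algebra (LBA) is a pair $(A,I)$, where $A$ is a Boolean algebra and $I$ is an ideal of $A$ (possibly non-proper) which is dense in $A$, i.e. for every $a\in A\setminus\{0\}$ there is $b\in I\setminus\{0\}$ with $b\le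 a$. An LBA $(B,I)$ is a ZLB-algebra (ZLBA) if for every $J\in Si(I)$ the join $\bigvee_B J$ exists in $B$. The category $\mathbf{ZLBA}$ has ZLBAs as objects; its morphisms $\varphi:(A,I)\to(B,J)$ are the Boolean homomorphisms $\varphi:A\to B$ such that for every $b\in J$ there exists $a\in I$ with $b\le\varphi(a)$; composition is the usual composition of functions. Two categories are dually equivalent if one is equivalent to the opposite of the other. *)

(* Defs.v *)
From HB Require Import structures.
From mathcomp Require Import all_boot all_order.
From mathcomp Require Import boolp classical_sets filter topology.

Set Implicit Arguments.
Unset Strict Implicit.
Unset Printing Implicit Defensive.

Import Order.TTheory.

Local Open Scope classical_set_scope.
Local Open Scope order_scope.

Record category := Category {
  obj :> Type;
  hom : obj -> obj -> Type;
  idm : forall x, hom x x;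
  cmp : forall x y z, hom y z -> hom x y -> hom x z;
  cmp1m : forall x y (f : hom x y), cmp (idm y) f = f;
  cmpm1 : forall x y (f : hom x y), cmp f (idm x) = f;
  cmpA : forall x y z t (f : hom z t) (g : hom y z) (h : hom x y),
    cmp f (cmp g h) = cmp (cmp f g) h }.

Arguments hom {c} x y.
Arguments idm {c} x.
Arguments cmp {c x y z} g f.

Definition opposite (C : category) : category :=
  @Category C (fun x y => @hom C y x) (@idm C)
    (fun x y z g f => @cmp C z y x f g)
    (fun x y f => @cmpm1 C y x f)
    (fun x y f => @cmp1m C y x f)
    (fun x y z t f g h => esym (@cmpA C t z y x h g f)).

Record functor (C D : category) := Functor {
  fobj :> C -> D;
  fhom : forall x y : C, hom x y -> hom (fobj x) (fobj y);
  fhom1 : forall x : C, fhom (idm x) = idm (fobj x);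
  fhomM : forall (x y z : C) (g : hom y z) (f : hom x y),
    fhom (cmp g f) = cmp (fhom g) (fhom f) }.

Arguments fhom {C D} f {x y} g : rename.

Definition functor_id (C : category) : functor C C :=
  @Functor C C (fun x => x) (fun x y f => f)
    (fun x => erefl) (fun x y z g f => erefl).

Lemma functor_comp1 (C D E : category) (G : functor D E) (F : functor C D)
  (x : C) : fhom G (fhom F (idm x)) = idm (G (F x)).
Proof. by rewrite !fhom1. Qed.

Lemma functor_compM (C D E : category) (G : functor D E) (F : functor C D)
    (x y z : C) (g : hom y z) (f : hom x y) :
  fhom G (fhom F (cmp g f)) = cmp (fhom G (fhom F g)) (fhom G (fhom F f)).
Proof. by rewrite !fhomM. Qed.

Definition functor_comp (C D E : category) (G : functor D E)
    (F : functor C D) : functor C E :=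
  @Functor C E (fun x => G (F x)) (fun x y f => fhom G (fhom F f))
    (functor_comp1 G F) (functor_compM G F).

Definition isomorphism (C : category) (x y : C) (f : hom x y) : Prop :=
  exists g : hom y x, cmp g f = idm x /\ cmp f g = idm y.

Definition naturally_isomorphic (C D : category) (F G : functor C D) : Prop :=
  exists eta : forall x : C, hom (F x) (G x),
    (forall x, isomorphism (eta x)) /\
    (forall (x y : C) (f : hom x y),
      cmp (eta y) (fhom F f) = cmp (fhom G f) (eta x)).

Definition equivalent (C D : category) : Prop :=
  exists (F : functor C D) (G : functor D C),
    naturally_isomorphic (functor_comp G F) (functor_id C) /\
    naturally_isomorphic (functor_comp F G) (functor_id D).

Definition dually_equivalent (C D : category) : Prop :=
  equivalent C (opposite D).

Definition lower_adjoint {d d' : Order.disp_t} {P : porderType d}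
    {Q : porderType d'} (phi : P -> Q) (psi : Q -> P) : Prop :=
  {homo psi : x y / x <= y} /\
  (forall (p : P) (q : Q), (q <= phi p) <-> (psi q <= p)).

Definition has_lower_adjoint {d d' : Order.disp_t} {P : porderType d}
    {Q : porderType d'} (phi : P -> Q) : Prop :=
  exists psi : Q -> P, lower_adjoint phi psi.

(* Boolean algebras are [ctbDistrLatticeType]s; the one-element algebra is
   allowed. A {0}-pseudolattice [I] contained in a Boolean algebra [A] is a
   [set A], with the order and the operations of [A]. *)

Section Ideals.
Context {d : Order.disp_t} {A : ctbDistrLatticeType d}.
Implicit Types (I J K : set A).

(* [J] is an element of Idl(I) *)
Definition ideal_of I J : Prop :=
  [/\ J `<=` I, J \bot,
      forall a b, I a -> J b -> a <= b -> J a
    & forall a b, J a -> J b -> J (a `|` b)].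

(* the join in Idl(I): the least element of Idl(I) above [J] and [K] *)
Definition ideal_join I J K : set A :=
  [set a | forall M, ideal_of I M -> J `<=` M -> K `<=` M -> M a].

Definition ideal_neg I J : set A :=
  [set a | I a /\ forall b, J b -> a `&` b = \bot].

Definition simple_ideal I J : Prop :=
  ideal_of I J /\ ideal_join I J (ideal_neg I J) = I.

Definition dense_ideal I : Prop :=
  forall a : A, a != \bot -> exists b, [/\ I b, b != \bot & b <= a].

End Ideals.

Record lba := Lba {
  lba_disp : Order.disp_t;
  lba_alg :> ctbDistrLatticeType lba_disp;
  lba_ideal : set lba_alg;
  lba_idealP : ideal_of setT lba_ideal;
  lba_dense : dense_ideal lba_ideal }.

Arguments lba_ideal : clear implicits.

Record zlba := Zlba {
  zlba_lba :> lba;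
  zlba_joins : forall J, simple_ideal (lba_ideal zlba_lba) J ->
    supremums J !=set0 }.

(* The library's [{tblmorphism _ -> _}] only asks for the preservation of
   [\bot] and [\top], not of meets and joins. *)
Definition boolean_hom {d d' : Order.disp_t} {A : ctbDistrLatticeType d}
    {B : ctbDistrLatticeType d'} (phi : A -> B) : Prop :=
  [/\ Order.meet_morphism phi, Order.join_morphism phi,
      {morph phi : x / ~` x}, phi \bot = \bot & phi \top = \top].

Definition zlba_morphism (A B : zlba) (phi : A -> B) : Prop :=
  boolean_hom phi /\
  forall b, lba_ideal B b -> exists2 a, lba_ideal A a & b <= phi a.

Definition opzlba_morphism (A B : zlba) (phi : A -> B) : Prop :=
  [/\ zlba_morphism phi,
      phi @` (lba_ideal A) `<=` lba_ideal B
    & has_lower_adjoint phi].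

Lemma zlba_morphism_id (A : zlba) : zlba_morphism (@id A).
Proof. by split; [split|move=> b Ib; exists b]. Qed.

Lemma zlba_morphism_comp (A B C : zlba) (psi : B -> C) (phi : A -> B) :
  zlba_morphism psi -> zlba_morphism phi -> zlba_morphism (psi \o phi).
Proof.
move=> [[psiI psiU psiC psi0 psi1] psiJ] [[phiI phiU phiC phi0 phi1] phiJ].
split; first split.
- by move=> x y /=; rewrite phiI psiI.
- by move=> x y /=; rewrite phiU psiU.
- by move=> x /=; rewrite phiC psiC.
- by rewrite /= phi0.
- by rewrite /= phi1.
move=> c /psiJ[b /phiJ[a Ia le_b] le_c]; exists a => //=.
apply: (le_trans le_c).
have /meet_idPl <- := le_b.
by rewrite psiI leIr.
Qed.

Lemma opzlba_morphism_id (A : zlba) : opzlba_morphism (@id A).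
Proof.
split; first exact: zlba_morphism_id.
- by move=> _ [a Ia <-].
- by exists id; split=> [x y|p q] /=.
Qed.

Lemma opzlba_morphism_comp (A B C : zlba) (psi : B -> C) (phi : A -> B) :
  opzlba_morphism psi -> opzlba_morphism phi -> opzlba_morphism (psi \o phi).
Proof.
move=> [psiM psiI [psi' [psi'_homo psi'P]]] [phiM phiI [phi' [phi'_homo phi'P]]].
split; first exact: zlba_morphism_comp.
- by move=> _ [a Ia <-]; apply: psiI; exists (phi a) => //; apply: phiI; exists a.
- exists (phi' \o psi'); split; first by move=> x y xy; exact/phi'_homo/psi'_homo.
  by move=> p q /=; rewrite psi'P phi'P.
Qed.

Definition opzlba_hom (A B : zlba) := {phi : A -> B | opzlba_morphism phi}.

Definition opzlba_id (A : zlba) : opzlba_hom A A :=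
  exist _ id (opzlba_morphism_id A).

Definition opzlba_comp (A B C : zlba) (psi : opzlba_hom B C)
    (phi : opzlba_hom A B) : opzlba_hom A C :=
  exist _ (sval psi \o sval phi) (opzlba_morphism_comp (svalP psi) (svalP phi)).

Lemma opzlba_comp1m (A B : zlba) (phi : opzlba_hom A B) :
  opzlba_comp (opzlba_id B) phi = phi.
Proof. by case: phi => phi phiP; exact: eq_exist. Qed.

Lemma opzlba_compm1 (A B : zlba) (phi : opzlba_hom A B) :
  opzlba_comp phi (opzlba_id A) = phi.
Proof. by case: phi => phi phiP; exact: eq_exist. Qed.

Lemma opzlba_compA (A B C D : zlba) (h : opzlba_hom C D) (g : opzlba_hom B C)
    (f : opzlba_hom A B) :
  opzlba_comp h (opzlba_comp g f) = opzlba_comp (opzlba_comp h g) f.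
Proof. exact: eq_exist. Qed.

Definition OPZLBA : category :=
  Category opzlba_comp1m opzlba_compm1 opzlba_compA.

(* Not the library's [zero_dimensional], which only asks that distinct points
   be separated by a clopen set. *)
Definition zero_dimensional_space (X : topologicalType) : Prop :=
  basis [set U : set X | clopen U].

Definition zlc_space (X : topologicalType) : Prop :=
  [/\ zero_dimensional_space X, locally_compact [set: X] & hausdorff_space X].

Definition closed_map (X Y : topologicalType) (f : X -> Y) : Prop :=
  forall F : set X, closed F -> closed (f @` F).

Definition open_map (X Y : topologicalType) (f : X -> Y) : Prop :=
  forall U : set X, open U -> open (f @` U).

Definition perfect_map (X Y : topologicalType) (f : X -> Y) : Prop :=
  [/\ continuous f, closed_map f & forall y : Y, compact (f @^-1` [set y])].

Section Clopens.
Variable X : topologicalType.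

Definition clopen_pred : pred (set X) := fun U => `[< clopen U >].

Definition CO : Type := {U : set X | clopen_pred U}.

HB.instance Definition _ := [isSub of CO for @proj1_sig _ _].
HB.instance Definition _ := [Choice of CO by <:].

Lemma clopen_meet_closed : Order.ClosedPredicates.meet_closed clopen_pred.
Proof.
move=> U V /asboolP cU /asboolP cV.
by apply/asboolP; exact: clopenI.
Qed.

Lemma clopen_join_closed : Order.ClosedPredicates.join_closed clopen_pred.
Proof.
move=> U V /asboolP cU /asboolP cV.
by apply/asboolP; exact: clopenU.
Qed.

Lemma clopen_bot : \bot \in clopen_pred.
Proof. exact/asboolP/clopen0. Qed.

Lemma clopen_top : \top \in clopen_pred.
Proof. exact/asboolP/clopenT. Qed.

Fact CO_display : Order.disp_t. Proof. by []. Qed.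

HB.instance Definition _ := Order.SubChoice_isTBSubLattice.Build
  set_display (set X) clopen_pred CO_display CO
  clopen_meet_closed clopen_join_closed clopen_bot clopen_top.

Lemma CO_meetUl : @left_distributive CO CO Order.meet Order.join.
Proof. by move=> U V W; apply: val_inj; exact: setIUl. Qed.

HB.instance Definition _ :=
  Order.Lattice_Meet_isDistrLattice.Build CO_display CO CO_meetUl.

Lemma clopen_predC (U : CO) : clopen_pred (~` val U)%classic.
Proof. by apply/asboolP; apply: (clopenC setT); exact/asboolP/(valP U). Qed.

Definition CO_compl (U : CO) : CO := Sub _ (clopen_predC U).

Lemma CO_joinxC (U : CO) : U `|` CO_compl U = \top.
Proof. by apply: val_inj; exact: setUv. Qed.

Lemma CO_meetxC (U : CO) : U `&` CO_compl U = \bot.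
Proof. by apply: val_inj; exact: setICr. Qed.

HB.instance Definition _ :=
  Order.TBDistrLattice_hasComplement.Build CO_display CO CO_joinxC CO_meetxC.

End Clopens.

Section Theta.
Variables (X Y : topologicalType) (f : X -> Y) (fP : perfect_map f).

Lemma Theta_subproof (G : CO Y) : clopen_pred (f @^-1` val G).
Proof.
apply/asboolP/preimage_clopen; last by case: fP.
exact/asboolP/(valP G).
Qed.

Definition Theta (G : CO Y) : CO X := Sub (f @^-1` val G) (Theta_subproof G).

End Theta.

Lemma perfect_map_id (X : topologicalType) : perfect_map (@id X).
Proof.
split=> [x| F |y]; first exact: cvg_id.
- by rewrite image_id.
- by rewrite preimage_id; exact: compact_set1.
Qed.

Lemma perfect_preimage_compact (X Y : topologicalType) (f : X -> Y)
    (K : set Y) :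
  perfect_map f -> compact K -> compact (f @^-1` K).
Proof.
move=> [_ fcl fK] cK F FF FfK.
have [y [Ky yF]] := cK (f @ F) _ FfK.
pose G := filter_from F (fun V => f @^-1` [set y] `&` closure V)%classic.
have GG : ProperFilter G.
  apply: filter_from_proper; first apply: filter_from_filter.
  - by exists setT; exact: filterT.
  - move=> U V FU FV; exists (U `&` V)%classic; first exact: filterI.
    move=> x [fx clx]; split; split=> //; move: x clx {fx};
      by apply: closureS => x [].
  move=> V FV.
  have : (f @` closure V)%classic y.
    apply: (fcl _ (@closed_closure _ V)) => N Ny.
    apply: yF => //=; rewrite /fmap/=.
    by apply: (filterS _ FV) => x Vx; exists x => //; exact: subset_closure.
  by move=> [x clx fxy]; exists x.
have [|x [fx xG]] := fK y G GG.
  by exists setT; [exact: filterT|move=> x []].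
exists x; split; first by rewrite /preimage/= fx.
move=> V N FV; rewrite nbhsE => -[O [oO Ox] ON].
have GV : G (f @^-1` [set y] `&` closure V)%classic by exists V.
have [z [[_ clz] Oz]] := xG _ O GV (open_nbhs_nbhs (conj oO Ox)).
have [w [Vw Ow]] := clz O (open_nbhs_nbhs (conj oO Oz)).
by exists w; split=> //; exact: ON.
Qed.

Lemma perfect_map_comp (X Y Z : topologicalType) (g : Y -> Z) (f : X -> Y) :
  perfect_map g -> perfect_map f -> perfect_map (g \o f).
Proof.
move=> gP fP; have [gc gcl gK] := gP; have [fc fcl fK] := fP; split.
- by move=> x; apply: continuous_comp; [exact: fc|exact: gc].
- by move=> F cF; rewrite -image_comp; exact/gcl/fcl.
- move=> z; rewrite comp_preimage; exact/perfect_preimage_compact.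
Qed.

Lemma open_map_id (X : topologicalType) : open_map (@id X).
Proof. by move=> U; rewrite image_id. Qed.

Lemma open_map_comp (X Y Z : topologicalType) (g : Y -> Z) (f : X -> Y) :
  open_map g -> open_map f -> open_map (g \o f).
Proof. by move=> go fo U oU; rewrite -image_comp; exact/go/fo. Qed.

Record zlc := Zlc {
  zlc_top :> topologicalType;
  zlcP : zlc_space zlc_top }.

Definition opzlc_morphism (X Y : zlc) (f : X -> Y) : Prop :=
  open_map f /\ perfect_map f.

Lemma opzlc_morphism_id (X : zlc) : opzlc_morphism (@id X).
Proof. by split; [exact: open_map_id|exact: perfect_map_id]. Qed.

Lemma opzlc_morphism_comp (X Y Z : zlc) (g : Y -> Z) (f : X -> Y) :
  opzlc_morphism g -> opzlc_morphism f -> opzlc_morphism (g \o f).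
Proof.
by move=> [go gp] [fo fp]; split; [exact: open_map_comp|exact: perfect_map_comp].
Qed.

Definition opzlc_hom (X Y : zlc) := {f : X -> Y | opzlc_morphism f}.

Definition opzlc_id (X : zlc) : opzlc_hom X X :=
  exist _ id (opzlc_morphism_id X).

Definition opzlc_comp (X Y Z : zlc) (g : opzlc_hom Y Z) (f : opzlc_hom X Y) :
    opzlc_hom X Z :=
  exist _ (sval g \o sval f) (opzlc_morphism_comp (svalP g) (svalP f)).

Lemma opzlc_comp1m (X Y : zlc) (f : opzlc_hom X Y) :
  opzlc_comp (opzlc_id Y) f = f.
Proof. by case: f => f fP; exact: eq_exist. Qed.

Lemma opzlc_compm1 (X Y : zlc) (f : opzlc_hom X Y) :
  opzlc_comp f (opzlc_id X) = f.
Proof. by case: f => f fP; exact: eq_exist. Qed.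

Lemma opzlc_compA (X Y Z T : zlc) (h : opzlc_hom Z T) (g : opzlc_hom Y Z)
    (f : opzlc_hom X Y) :
  opzlc_comp h (opzlc_comp g f) = opzlc_comp (opzlc_comp h g) f.
Proof. exact: eq_exist. Qed.

Definition OPZLC : category :=
  Category opzlc_comp1m opzlc_compm1 opzlc_compA.

(* Main.v *)
From HB Require Import structures.
Require Import Defs.
From mathcomp Require Import all_boot all_order.
From mathcomp Require Import boolp classical_sets filter topology.

(** (a) If [f] is open and closed, then direct image maps clopen sets to clopen
    sets, and it is left adjoint to inverse image. Conversely, suppose that
    [psi] is a lower adjoint of inverse image. A closed set of a
    zero-dimensional space is the intersection of the clopen sets above it, and
    [psi U] is by adjunction the least clopen set above [f @` U]; as [f @` U]
    is closed, it equals [psi U]. So [f] maps a base of open sets to open sets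
    ([lower_adjoint_open_map]).

    (b) The functor sending [X] to its clopen algebra, with the compact clopen
    sets as ideal, and [f] to inverse image, is fully faithful and essentially
    surjective as a contravariant functor; this suffices
    ([fully_faithful_esssurj_equivalent]).

    It is full: given [phi : CO Y -> CO X] and a point [x], the clopens [V] of
    [Y] with [x] in [phi V] form an ultrafilter, which has a compact member
    because [phi] is cofinal on the ideals; by compactness it is the
    ultrafilter of clopen neighbourhoods of a point, and this point is [f x].
    Then [f^-1 V = phi V], whence [f] is continuous; it is perfect because
    [phi] preserves compact clopens, and open by (a).

    It is essentially surjective: a ZLB-algebra [(A, I)] is represented by the
    space of ultrafilters of [A] that meet [I], with the sets
    [stone a = {p | a \in p}] as base. For [a] in [I], [stone a] is compact,
    and [stone] is injective because [I] is dense. Given a clopen [U], the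
    elements of [I] below [U] form a simple ideal, so that they have a join
    in [A]; [stone] maps this join to [U] ([stone_surj]). This is where the
    completeness condition of a ZLB-algebra is used. The inverse of an
    isomorphism of algebras is also its lower adjoint, so that [stone] is an
    isomorphism of the restricted category. *)

Set Implicit Arguments.
Unset Strict Implicit.
Unset Printing Implicit Defensive.

Import Order.Theory.

Local Open Scope classical_set_scope.
Local Open Scope order_scope.

(** * Equivalences of categories *)

(** The quasi-inverse is built by choice from preimages of objects and of
    morphisms; faithfulness makes the chosen preimages functorial. *)
Lemma fully_faithful_esssurj_equivalent (C D : category) (F : functor C D) :
  (forall (x y : C) (f g : hom x y), fhom F f = fhom F g -> f = g) ->
  (forall (x y : C) (h : hom (F x) (F y)), exists f, fhom F f = h) ->
  (forall y : D, exists (x : C) (e : hom (F x) y), isomorphism e) ->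
  equivalent C D.
Proof.
move=> faith full es.
pose pre x y h := sval (cid (full x y h)).
have preK x y h : fhom F (@pre x y h) = h by rewrite /pre; case: cid.
pose g y := sval (cid (es y)).
have es' y : exists e : hom (F (g y)) y, isomorphism e.
  by rewrite /g; case: cid.
pose e y := sval (cid (es' y)).
have eiso y : isomorphism (e y) by rewrite /e; case: cid.
pose i y := sval (cid (eiso y)).
have [ie ei] : (forall y, cmp (i y) (e y) = idm (F (g y))) /\
    forall y, cmp (e y) (i y) = idm y.
  by split=> y; rewrite /i; case: cid => ? [].
pose gh y z (h : hom y z) : hom (g y) (g z) :=
  pre _ _ (cmp (i z) (cmp h (e y))).
have gh1 y : gh y y (idm y) = idm (g y).
  by apply: faith; rewrite preK cmp1m ie fhom1.
have ghM x y z (h : hom y z) (k : hom x y) :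
    gh x z (cmp h k) = cmp (gh y z h) (gh x y k).
  apply: faith; rewrite fhomM !preK -!cmpA; congr cmp; congr cmp.
  by rewrite [RHS]cmpA ei cmp1m.
pose G := Functor gh1 ghM.
exists F, G; split.
- exists (fun x => pre _ _ (e (F x))); split=> [x|x y f].
    exists (pre _ _ (i (F x))).
    by split; apply: faith; rewrite fhomM !preK fhom1 ?ie ?ei.
  by apply: faith; rewrite /= !fhomM !preK cmpA ei cmp1m.
- exists e; split=> // x y f /=.
  by rewrite preK cmpA ei cmp1m.
Qed.

(** * Compact and clopen sets *)

Section Topology.
Local Open Scope classical_set_scope.
Implicit Types X Y : topologicalType.

(** Finite subcovers of a directed cover collapse to a single member; in this
    form compactness never requires finite families. *)
Lemma compact_directed_cover X (K : set X) (I : Type) (D : set I)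
    (V : I -> set X) :
  compact K -> D !=set0 ->
  (forall i j, D i -> D j -> exists2 k, D k & V i `|` V j `<=` V k) ->
  (forall x, K x -> exists2 i, D i & nbhs x (V i)) ->
  exists2 i, D i & K `<=` V i.
Proof.
move=> /compact_near_coveringP cK D0 dirD covK.
pose F := filter_from D (fun i => [set j | D j /\ V i `<=` V j]).
have FF : Filter F.
  apply: filter_from_filter => // i j Di Dj.
  have [k Dk ijk] := dirD i j Di Dj.
  exists k => // l [Dl kl].
  by split; split=> // x Vx; apply/kl/ijk; [left|right].
have [|i Di KVi] := cK I F (fun i x => D i /\ V i x) FF.
  move=> x /covK[i Di xVi].
  exists (V i, [set j | D j /\ V i `<=` V j]); first by split => //; exists i.
  by move=> [y j] /= [Viy [Dj ij]]; split => //; exact: ij.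
exists i => // x Kx.
by have [] := KVi i (conj Di (@subset_refl _ _)) x Kx.
Qed.

Lemma clopen_nbhs X (U : set X) (x : X) :
  zero_dimensional_space X -> open U -> U x ->
  exists V, [/\ clopen V, V x & V `<=` U].
Proof.
move=> [_ /(_ x) bX] oU Ux.
have [V [cV Vx] VU] := bX U (open_nbhs_nbhs (conj oU Ux)).
by exists V.
Qed.

Lemma compact_clopen_nbhs X (U : set X) (x : X) :
  zlc_space X -> open U -> U x ->
  exists V, [/\ clopen V, compact V, V x & V `<=` U].
Proof.
move=> [zX lX hX] oU Ux.
have [C] := lX x I.
rewrite withinET => nC [cC clC].
have [||V [cV Vx VCU]] := @clopen_nbhs X (interior C `&` U) x zX.
- by apply: openI => //; exact: open_interior.
- by [].
exists V; split=> //.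
  apply: (subclosed_compact _ cC); first by case: cV.
  by move=> y /VCU[/interior_subset].
by move=> y /VCU[].
Qed.

End Topology.

(** * Open maps and lower adjoints *)

Section ClopenAlgebra.
Variable X : topologicalType.
Implicit Types (U V : CO X) (x : X).

Lemma clopen_val U : clopen (val U).
Proof. exact/asboolP/(valP U). Qed.

Definition clopen_CO (V : set X) (cV : clopen V) : CO X :=
  Sub V (asboolT cV).

Lemma CO_leP U V : reflect (val U `<=` val V) (U <= V).
Proof. by rewrite leEsub; apply: (iffP idP); rewrite subsetEset. Qed.

Lemma CO_complE U : val (~` U)%O = (~` val U)%classic.
Proof. by []. Qed.

End ClopenAlgebra.

Lemma open_map_lower_adjoint (X Y : topologicalType) (f : X -> Y)
    (fP : perfect_map f) :
  open_map f -> has_lower_adjoint (Theta fP).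
Proof.
move=> fo; have [_ fcl _] := fP.
have cfU (U : CO X) : clopen (f @` val U).
  by have [oU cU] := clopen_val U; split; [exact: fo|exact: fcl].
exists (fun U => clopen_CO (cfU U)); split=> [U V /CO_leP UV|G U].
  by apply/CO_leP; exact: image_subset.
split=> /CO_leP UG; apply/CO_leP.
  by move=> _ [x Ux <-]; exact: UG.
by move=> x Ux; apply: UG; exists x.
Qed.

(** [psi U] is the least clopen set above the closed set [f @` U], and a closed
    set of a zero-dimensional space is the intersection of the clopen sets
    above it; hence [f @` U = psi U] is open for every clopen [U]. *)
Lemma lower_adjoint_open_map (X Y : topologicalType) (f : X -> Y)
    (fP : perfect_map f) :
  zero_dimensional_space X -> zero_dimensional_space Y ->
  has_lower_adjoint (Theta fP) -> open_map f.
Proof.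
move=> zX zY [psi [_ psiP]]; have [_ fcl _] := fP.
have fU (U : CO X) : f @` val U = val (psi U).
  apply/seteqP; split.
    move=> _ [x Ux <-].
    by have /(psiP (psi U) U)/CO_leP := lexx (psi U); exact.
  apply: contrapT; move=> /existsNP[y /not_implyP[psiUy nfUy]].
  have [_ cU] := clopen_val U.
  have [|V [cV Vy VfU]] := @clopen_nbhs Y (~` (f @` val U))%classic y zY _ nfUy.
    exact/closed_openC/fcl.
  (* a clopen neighbourhood of [y] missing [f @` U] has a complement above
     [f @` U], hence above [psi U] *)
  have /psiP/CO_leP : U <= Theta fP (~` clopen_CO cV)%O.
    apply/CO_leP => x Ux; rewrite /Theta SubK CO_complE => Vfx.
    by apply: (VfU _ Vfx); exists x.
  by move=> /(_ y psiUy); rewrite CO_complE; exact.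
move=> W oW; rewrite openE => _ [x Wx <-].
have [V [cV Vx VW]] := clopen_nbhs zX oW Wx.
have := fU (clopen_CO cV); rewrite /= => fV.
have [ofV _] := clopen_val (psi (clopen_CO cV)).
rewrite /interior nbhsE; exists (f @` V); last exact: image_subset.
by split; [rewrite fV|exists x].
Qed.

(** * The contravariant clopen functor *)

Definition KO (X : topologicalType) : set (CO X) := [set U | compact (val U)].

Lemma compact_clopen_cover (X : topologicalType) (K : set X) :
  zlc_space X -> compact K -> exists2 U : CO X, KO U & K `<=` val U.
Proof.
move=> zX cK.
apply: (@compact_directed_cover X K (CO X) (@KO X) val) => //.
- by exists \bot; exact: compact0.
- by move=> U V cU cV; exists (U `|` V) => //; exact: compactU.
- move=> x _.
  have [V [cV kV Vx _]] := compact_clopen_nbhs zX openT (I : setT x).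
  exists (clopen_CO cV) => //; apply: open_nbhs_nbhs; split=> //.
  by case: cV.
Qed.

Lemma KO_ideal (X : topologicalType) : ideal_of setT (@KO X).
Proof.
split=> //; first exact: compact0.
- move=> U V _ cV /CO_leP UV; apply: subclosed_compact cV UV.
  by case: (clopen_val U).
- by move=> U V cU cV; exact: compactU.
Qed.

Lemma KO_dense (X : topologicalType) : zlc_space X -> dense_ideal (@KO X).
Proof.
move=> zX U U0.
have [x Ux] : val U !=set0.
  by apply/set0P; apply: contra U0 => /eqP U0; apply/eqP/val_inj.
have [oU _] := clopen_val U.
have [V [cV kV Vx VU]] := compact_clopen_nbhs zX oU Ux.
exists (clopen_CO cV); split=> //; last exact/CO_leP.
by apply: contraPneq Vx => /(congr1 val) /= ->.
Qed.

(** The elements of the form [b `|` c] are an ideal containing [J] and its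
    pseudocomplement: by distributivity an element below [b `|` c] is the join
    of its meets with [b] and [c]. *)
Lemma simple_ideal_cover d (A : ctbDistrLatticeType d) (I J : set A) a :
  ideal_of setT I -> simple_ideal I J -> I a ->
  exists b c, [/\ J b, ideal_neg I J c & a = b `|` c].
Proof.
move=> [_ I0 Idown IU] [[JI J0 Jdown JU] IE] Ia.
have /(_ [set x | exists b c, [/\ J b, ideal_neg I J c & x = b `|` c]]) :
  ideal_join I J (ideal_neg I J) a by rewrite IE.
apply.
- split.
  + move=> _ [b [c [Jb [Ic _] ->]]]; apply: IU => //; exact: JI.
  + exists \bot, \bot; rewrite joinxx; split=> //.
    by split=> // x _; rewrite meet0x.
  + move=> x _ Ix [b [c [Jb [Ic cJ] ->]]] /meet_idPl xbc.
    exists (x `&` b), (x `&` c); split.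
    * by apply: (Jdown _ b) => //; [exact: Idown (leIl _ _)|exact: leIr].
    * split; first exact: Idown (leIl _ _).
      by move=> y /cJ cy; rewrite -meetA cy meetx0.
    * by rewrite -meetUr.
  + move=> _ _ [b [c [Jb [Ic cJ] ->]]] [b' [c' [Jb' [Ic' cJ'] ->]]].
    exists (b `|` b'), (c `|` c'); split; first exact: JU.
      split; first exact: IU.
      by move=> y Jy; rewrite meetUl cJ ?cJ' ?joinxx.
    by rewrite joinACA.
- move=> b Jb; exists b, \bot; rewrite joinx0; split=> //.
  by split=> // x _; rewrite meet0x.
- by move=> c Jc; exists \bot, c; rewrite join0x.
Qed.

(** The join is the union of [J]: a compact clopen neighbourhood of a point
    outside the union splits into a member of [J] and a clopen set disjoint
    from all members of [J], and the point lies in the latter. So the union is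
    closed as well as open. *)
Lemma KO_joins (X : topologicalType) : zlc_space X ->
  forall J, simple_ideal (@KO X) J -> supremums J !=set0.
Proof.
move=> zX J sJ.
have cU : clopen (\bigcup_(V in J) val V).
  split; first by apply: bigcup_open => V _; case: (clopen_val V).
  rewrite -[X in closed X]setCK; apply: open_closedC.
  rewrite openE => x nUx.
  have [K [cK kK Kx _]] := compact_clopen_nbhs zX openT (I : setT x).
  have [V [W [JV [_ WJ] KVW]]] :=
    simple_ideal_cover (KO_ideal X) sJ (kK : KO (clopen_CO cK)).
  have /= KE := congr1 val KVW.
  have Wx : val W x.
    by move: Kx; rewrite KE => -[Vx|//]; case: nUx; exists V.
  have [oW _] := clopen_val W.
  rewrite /interior nbhsE; exists (val W) => // y Wy [V' JV' V'y].
  by have /(congr1 val)/= := WJ _ JV'; rewrite -subset0 => /(_ y); apply.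
exists (clopen_CO cU); split.
  by move=> V JV; apply/CO_leP; exact: bigcup_sup.
by move=> V ubV; apply/CO_leP => x [W /ubV/CO_leP]; exact.
Qed.

Definition CO_lba (X : zlc) : lba := Lba (KO_ideal X) (KO_dense (zlcP X)).
Definition CO_zlba (X : zlc) : zlba := @Zlba (CO_lba X) (KO_joins (zlcP X)).

Lemma Theta_boolean_hom (X Y : topologicalType) (f : X -> Y)
  (fP : perfect_map f) : boolean_hom (Theta fP).
Proof. by split=> [U V|U V|U||]; apply: val_inj. Qed.

Lemma Theta_opzlba_morphism (X Y : zlc) (f : opzlc_hom X Y) :
  @opzlba_morphism (CO_zlba Y) (CO_zlba X) (Theta (svalP f).2).
Proof.
case: f => f [fo fp] /=; have [fc _ _] := fp; split; first split.
- exact: Theta_boolean_hom.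
- move=> U kU.
  have cfU : compact (f @` val U).
    by apply: continuous_compact => //; apply: continuous_subspaceT.
  have [V kV fUV] := compact_clopen_cover (zlcP Y) cfU.
  by exists V => //; apply/CO_leP => x Ux; apply: fUV; exists x.
- by move=> _ [V kV <-]; exact: perfect_preimage_compact.
- exact: open_map_lower_adjoint.
Qed.

Definition CO_hom (X Y : OPZLC) (f : hom X Y) :
    @hom (opposite OPZLBA) (CO_zlba X) (CO_zlba Y) :=
  exist _ _ (Theta_opzlba_morphism f).

Lemma CO_hom1 (X : OPZLC) : CO_hom (idm X) = idm (CO_zlba X : opposite OPZLBA).
Proof. by apply: eq_exist; apply/funext => U; apply: val_inj. Qed.

Lemma CO_homM (X Y Z : OPZLC) (g : hom Y Z) (f : hom X Y) :
  CO_hom (cmp g f) = cmp (CO_hom g) (CO_hom f).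
Proof. by apply: eq_exist; apply/funext => U; apply: val_inj. Qed.

Definition CO_functor : functor OPZLC (opposite OPZLBA) :=
  Functor CO_hom1 CO_homM.

(** * The clopen functor is fully faithful *)

(** If [y] is outside [f @` C], take a compact clopen neighbourhood [V] of [y]:
    over [V] the image of [C] is compact, hence closed, and can be removed
    from [V]. *)
Lemma perfect_of_compact_preimages (X Y : topologicalType) (f : X -> Y) :
  zlc_space Y -> continuous f ->
  (forall V : CO Y, KO V -> compact (f @^-1` val V)) -> perfect_map f.
Proof.
move=> zY fc fK; have [_ _ hY] := zY.
have nbhsK y : exists V : CO Y, KO V /\ val V y.
  have [V [cV kV Vy _]] := compact_clopen_nbhs zY openT (I : setT y).
  by exists (clopen_CO cV).
split=> // [C cC|y].
  rewrite -[X in closed X]setCK; apply: open_closedC; rewrite openE => y nfCy.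
  have [V [kV Vy]] := nbhsK y.
  have cCV : closed (f @` (f @^-1` val V `&` C))%classic.
    apply: compact_closed => //; apply: continuous_compact.
      exact: continuous_subspaceT.
    by apply: compact_closedI => //; exact: fK.
  have [oV _] := clopen_val V.
  rewrite /interior nbhsE.
  exists (val V `&` ~` (f @` (f @^-1` val V `&` C)))%classic.
    split; first by apply: openI => //; exact: closed_openC.
    by split=> // -[x [_ Cx] fxy]; apply: nfCy; exists x.
  by move=> z [Vz nz] [x Cx fxz]; apply: nz; exists x => //; rewrite /= fxz.
have [V [kV Vy]] := nbhsK y.
apply: (subclosed_compact _ (fK V kV)); last by move=> x /= ->.
apply: preimage_closed => //.
exact: accessible_closed_set1 (hausdorff_accessible hY) _.
Qed.

Lemma CO_functor_faithful (X Y : OPZLC) (f g : hom X Y) :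
  fhom CO_functor f = fhom CO_functor g -> f = g.
Proof.
case: f g => [f fP] [g gP] /(congr1 sval)/= fg; apply: eq_exist.
apply/funext => x; apply: contrapT => fgx.
have [zY _ hY] := zlcP Y.
have [||V [cV Vf Vg]] := @clopen_nbhs Y (~` [set g x])%classic (f x) zY.
- apply: closed_openC.
  exact: accessible_closed_set1 (hausdorff_accessible hY) _.
- exact: fgx.
have /(congr1 val)/= := congr1 (@^~ (clopen_CO cV)) fg.
by move=> /(congr1 (@^~ x)) /= VfVg; apply: (Vg (g x)) => //; rewrite -VfVg.
Qed.

(** The clopens [V] with [x] outside [phi V] are directed. If the ultrafilter
    [{V | x \in phi V}] had no limit, they would cover every compact clopen
    [K], so that one of them would contain [K]; then [x] is outside [phi K].
    As [phi] is cofinal on the ideals, [x] lies in some [phi K]. *)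
Lemma pulled_back_ultrafilter_converges (X Y : zlc)
    (phi : CO_zlba Y -> CO_zlba X) :
  zlba_morphism phi ->
  forall x : X, exists y : Y, forall V : CO Y, val (phi V) x <-> val V y.
Proof.
move=> [[phiI phiU phiC phi0 phi1] phiK] x.
have [K kK phiKx] : exists2 K : CO Y, KO K & val (phi K) x.
  have [U [cU kU Ux _]] := compact_clopen_nbhs (zlcP X) openT (I : setT x).
  have [K kK /CO_leP UK] := phiK (clopen_CO cU) kU.
  by exists K => //; exact: UK.
apply: contrapT => /forallNP noy.
have [||y Ky|V nVx KV] := @compact_directed_cover Y (val K) (CO Y)
    [set V | ~ val (phi V) x] val kK.
- by exists \bot; rewrite /= phi0.
- move=> V W nVx nWx; exists (V `|` W) => //=.
  by rewrite phiU => -[].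
- have /existsNP[V nV] := noy y.
  have [oV _] := clopen_val V; have [oV' _] := clopen_val (~` V)%O.
  have [Vy|nVy] := pselect (val V y).
    by exists V; [move=> phiV; apply: nV|exact: open_nbhs_nbhs].
  exists (~` V)%O; last exact: open_nbhs_nbhs.
  by rewrite /= phiC => nphiV; apply: nV; split=> // phiV; case: (nphiV).
apply: nVx.
have /CO_leP : phi K <= phi V; last exact.
have /meet_idPl <- : K <= V by exact/CO_leP.
by rewrite phiI leIr.
Qed.

Lemma CO_functor_full (X Y : OPZLC) (h : hom (CO_functor X) (CO_functor Y)) :
  exists f : hom X Y, fhom CO_functor f = h.
Proof.
case: h => phi phiP; have [phiM phiI phiA] := phiP.
pose f x := sval (cid (pulled_back_ultrafilter_converges phiM x)).
have fE V : f @^-1` val V = val (phi V).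
  by apply/seteqP; split=> x /=; rewrite /f; case: cid => /= y yP /yP.
have fc : continuous f.
  apply/continuousP => W oW; rewrite openE => x Wfx.
  have [zY _ _] := zlcP Y.
  have [V [cV Vfx VW]] := clopen_nbhs zY oW Wfx.
  have [oV _] := clopen_val (phi (clopen_CO cV)).
  rewrite /interior nbhsE; exists (val (phi (clopen_CO cV))).
    by split=> //; rewrite -fE.
  by rewrite -fE => y /VW.
have fp : perfect_map f.
  apply: perfect_of_compact_preimages fc _; first exact: zlcP.
  by move=> V kV; rewrite fE; apply: phiI; exists V.
have phiE : Theta fp = phi.
  by apply/funext => V; apply: val_inj; rewrite -fE.
have fo : open_map f.
  have [[zX _ _] [zY _ _]] := (zlcP X, zlcP Y).
  by apply: (lower_adjoint_open_map (fP := fp)); rewrite ?phiE.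
exists (exist _ f (conj fo fp)); apply: eq_exist => /=.
by rewrite -phiE; congr Theta; exact: Prop_irrelevance.
Qed.

(** * Ultrafilters of a Boolean algebra *)

Section Ultrafilters.
Context d (A : ctbDistrLatticeType d).
Implicit Types (a b : A) (u : set A).

Definition ultrafilter u : Prop :=
  (forall a b, u (a `&` b) <-> u a /\ u b) /\ (forall a, u (~` a) <-> ~ u a).

Lemma ultrafilter_ge u a b : ultrafilter u -> a <= b -> u a -> u b.
Proof. by move=> [uI _] /meet_idPl <- /uI[]. Qed.

Lemma ultrafilter_bot u : ultrafilter u -> ~ u \bot.
Proof.
move=> uU u0; have := u0; rewrite -compl1 => /(uU.2 _); apply.
exact: ultrafilter_ge (le0x _) u0.
Qed.

Lemma ultrafilter_join u a b : ultrafilter u -> u (a `|` b) <-> u a \/ u b.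
Proof.
move=> uU; split=> [|[]]; last 2 first.
- exact: ultrafilter_ge uU (leUl _ _).
- exact: ultrafilter_ge uU (leUr _ _).
have [ua|/(uU.2 a) nua] := pselect (u a); first by left.
move=> uab; right; have /(uU.1 _ _) : u (a `|` b) /\ u (~` a) by [].
by rewrite meetUl meetxC join0x => /(uU.1 _ _)[].
Qed.

(** This reduces to the ultrafilter lemma for families of sets. The sets that
    contain all nonzero elements below some [q], for densely many [q] under
    [b], form a proper filter on [A]. Each set [{r | r <= a \/ r <= ~` a}] is
    in it, so that for any ultrafilter [U] refining it, the elements [a] with
    [{r | r <= a}] in [U] form an ultrafilter of [A]. *)
Lemma ultrafilter_exists b : b != \bot -> exists2 u, ultrafilter u & u b.
Proof.
move=> b0.
pose F : set_system A := [set D | forall p, p != \bot -> p <= b ->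
  exists q, [/\ q <= p, q != \bot & forall r, r != \bot -> r <= q -> D r]].
have FF : ProperFilter F.
  apply: Build_ProperFilter_ex.
    move=> D /(_ b b0 (lexx b))[q [_ q0 Dq]]; exists q; exact: Dq.
  split=> [p p0 pb|D E FD FE p p0 pb|D E DE FD p p0 pb].
  - by exists p.
  - have [q [qp q0 Dq]] := FD p p0 pb.
    have [r [rq r0 Er]] := FE q q0 (le_trans qp pb).
    exists r; split=> [||s s0 sr]; [exact: le_trans rq qp|exact: r0|].
    by split; [apply: Dq => //; exact: le_trans sr rq|exact: Er].
  - have [q [qp q0 Dq]] := FD p p0 pb.
    by exists q; split=> // r r0 /(Dq r r0)/DE.
have [U [UU FU]] := ultraFilterLemma FF.
have U0 : U [set r | r != \bot] by apply: FU => p p0 _; exists p.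
exists (fun a => U [set r | r <= a]); last first.
  by apply: FU => p p0 pb; exists p; split=> // r _ rp; exact: le_trans pb.
split=> [a c|a].
  split=> [Uac|[Ua Uc]].
    by split; apply: filterS Uac => r /=; rewrite lexI => /andP[].
  by apply: filterS (filterI Ua Uc) => r /= [ra rc]; rewrite lexI ra.
split=> [UCa Ua|nUa].
  have [r [[ra rCa] r0]] := filter_ex (filterI (filterI Ua UCa) U0).
  by move: r0; rewrite /= -lex0 -(meetxC a) lexI ra rCa.
have UaC : U [set r | r <= a \/ r <= ~` a].
  apply: FU => p p0 pb; have [pa0|pa0] := eqVneq (p `&` a) \bot.
    exists p; split=> // r _ rp; right; apply: le_trans rp _.
    by rewrite -disj_leC pa0.
  exists (p `&` a); split=> [||r _ ra]; [exact: leIl|exact: pa0|left].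
  by apply: le_trans ra _; exact: leIr.
have [//|UnA] := in_ultra_setVsetC [set r | r <= a] UU.
by apply: filterS (filterI UaC UnA) => r /= [[]].
Qed.

End Ultrafilters.

(** * The space of ultrafilters meeting an ideal *)

Section Spectrum.
Context d (A : ctbDistrLatticeType d) (I : set A).

Definition spec : Type :=
  {u : set A | ultrafilter u /\ exists2 a, I a & u a}.

Implicit Types (p q : spec) (a b : A).

HB.instance Definition _ := gen_eqMixin spec.
HB.instance Definition _ := gen_choiceMixin spec.

Definition stone a : set spec := [set p | sval p a].

Definition spec_open : set_system spec :=
  [set U | forall p, U p -> exists2 a, stone a p & stone a `<=` U].

Lemma specU p : ultrafilter (sval p).
Proof. by case: p => u []. Qed.

Lemma spec_inj p q : sval p = sval q -> p = q.
Proof. by case: p q => [u uP] [v vP]; exact: eq_exist. Qed.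

Lemma stoneI a b : stone (a `&` b) = (stone a `&` stone b)%classic.
Proof. by apply/seteqP; split=> p /((specU p).1 a b). Qed.

Lemma stoneC a : stone (~` a) = (~` stone a)%classic.
Proof. by apply/seteqP; split=> p /((specU p).2 a). Qed.

Lemma stoneU a b : stone (a `|` b) = (stone a `|` stone b)%classic.
Proof. by apply/seteqP; split=> p /(ultrafilter_join a b (specU p)). Qed.

Lemma stone0 : stone \bot = set0.
Proof. by apply/seteqP; split=> p // /(ultrafilter_bot (specU p)). Qed.

Lemma stone1 : stone \top = setT.
Proof. by rewrite -compl0 stoneC stone0 setC0. Qed.

Lemma stoneS a b : a <= b -> stone a `<=` stone b.
Proof. by move=> ab p; exact: ultrafilter_ge (specU p) ab. Qed.

Lemma spec_openT : spec_open setT.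
Proof. by move=> p _; exists \top => //; rewrite stone1. Qed.

Lemma spec_openI : setI_closed spec_open.
Proof.
move=> U V oU oV p [/oU[a pa aU] /oV[b pb bV]].
exists (a `&` b); rewrite stoneI; first by split.
exact: setISS.
Qed.

Lemma spec_open_bigcup (J : Type) (f : J -> set spec) :
  (forall j, spec_open (f j)) -> spec_open (\bigcup_j f j).
Proof.
move=> of_ p [j _ /of_[a pa af]]; exists a => //.
by apply: subset_trans af _; exact: bigcup_sup.
Qed.

HB.instance Definition _ :=
  isOpenTopological.Build spec spec_openT spec_openI spec_open_bigcup.

Lemma clopen_stone a : clopen (stone a).
Proof.
have oS b : open (stone b) by move=> p pb; exists b.
split; first exact: oS.
by rewrite -[stone a]setCK -stoneC; exact/open_closedC/oS.
Qed.

Lemma nbhs_stone p (U : set spec) :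
  nbhs p U -> exists2 a, stone a p & stone a `<=` U.
Proof.
rewrite nbhsE => -[V [oV Vp] VU].
have [a pa aV] := oV p Vp; exists a => //; exact: subset_trans VU.
Qed.

(** An ultrafilter [F] of sets of points converges to [{b | F (stone b)}], which
    is a point of the spectrum as soon as [F] contains [stone a] with [a] in
    [I]. *)
Lemma compact_stone a : I a -> compact (stone a).
Proof.
move=> Ia; rewrite compact_ultra => F FF Fa.
pose u : set A := [set b | F (stone b)].
have uU : ultrafilter u.
  split=> [b c|b]; rewrite /u /= ?stoneI ?stoneC.
    split=> [Fbc|[Fb Fc]]; last exact: filterI.
    by split; apply: filterS Fbc => p [].
  split=> [FCb Fb|nFb].
    by have [p []] := filter_ex (filterI FCb Fb).
  by case: (in_ultra_setVsetC (stone b) FF).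
have uI : exists2 b, I b & u b by exists a.
exists (exist _ u (conj uU uI)); split=> // U /nbhs_stone[b ub bU].
exact: filterS bU ub.
Qed.

Lemma spec_zlc : zlc_space spec.
Proof.
split.
- split; first by move=> U [].
  move=> p U /nbhs_stone[a pa aU]; exists (stone a) => //.
  by split=> //; exact: clopen_stone.
- move=> p _; rewrite withinET; have [_ [a Ia pa]] := svalP p.
  have [oa ca] := clopen_stone a.
  by exists (stone a); [exact: open_nbhs_nbhs|split=> //; exact: compact_stone].
- move=> p q clpq.
  have pq a : sval p a -> sval q a.
    move=> pa; apply: contrapT => /((specU q).2 a) qCa.
    have [||r [ra]] := clpq (stone a) (stone (~` a)).
    + by apply: open_nbhs_nbhs; split=> //; case: (clopen_stone a).
    + by apply: open_nbhs_nbhs; split=> //; case: (clopen_stone (~` a)).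
    + by rewrite stoneC; apply.
  apply: spec_inj; apply/seteqP; split=> a; first exact: pq.
  move=> qa; apply: contrapT => /((specU p).2 a)/pq.
  by move=> /((specU q).2 a); exact.
Qed.

End Spectrum.

Arguments stone {d A} I a.
Arguments clopen_stone {d A} I a.

(** * Representation of ZLB-algebras *)

Section StoneRepresentation.
Variable A : zlba.
Let I := lba_ideal A.
Implicit Types a b : A.

Definition Spec : zlc := Zlc (spec_zlc I).

Definition stone_CO a : CO_zlba Spec := clopen_CO (clopen_stone I a).

(** Density of the ideal provides a nonzero [b] in [I] below [a]; an ultrafilter
    containing [b] meets [I], that is, it is a point of the spectrum. *)
Lemma stone_neq0 a : a != \bot -> stone I a !=set0.
Proof.
move=> /(lba_dense (l := A))[b [Ib b0 ba]].
have [u uU ub] := ultrafilter_exists b0.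
have uI : exists2 c, I c & u c by exists b.
by exists (exist _ u (conj uU uI)); exact: ultrafilter_ge uU ba ub.
Qed.

Lemma stone_le a b : stone I a `<=` stone I b -> a <= b.
Proof.
move=> ab; rewrite -[b]complK -Order.CTBDistrLatticeTheory.disj_leC.
apply: contraT => /stone_neq0[p].
by rewrite stoneI stoneC => -[pa npb]; case: npb; exact: ab.
Qed.

(** The sets [stone a] with [a] in [I] are a base closed under finite unions, so
    compactness of [K] leaves a single one of them. *)
Lemma stone_cover (K : set Spec) (U : set Spec) :
  compact K -> open U -> K `<=` U ->
  exists2 a, I a & K `<=` stone I a /\ stone I a `<=` U.
Proof.
move=> cK oU KU; have [_ I0 Idown IU] := lba_idealP A.
have [|a b [Ia aU] [Ib bU]|p Kp|a [Ia aU] Ka] :=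
  @compact_directed_cover Spec K A [set a | I a /\ stone I a `<=` U] (stone I) cK.
- by exists \bot; split; rewrite ?stone0.
- exists (a `|` b); last by rewrite stoneU.
  by split; [exact: IU|rewrite stoneU => p [/aU|/bU]].
- have [a pa aU] := oU p (KU p Kp); have [_ [b Ib pb]] := svalP p.
  exists (a `&` b); rewrite /= stoneI.
    by split; [exact: Idown (leIr _ _)|move=> q [/aU]].
  have [oa _] := clopen_stone I a; have [ob _] := clopen_stone I b.
  by apply: open_nbhs_nbhs; split=> //; exact: openI.
- by exists a.
Qed.

Lemma compact_stoneE a : compact (stone I a) <-> I a.
Proof.
split=> [ca|]; last exact: compact_stone.
have [_ _ Idown _] := lba_idealP A.
have [b Ib [ab _]] := stone_cover ca openT (@subsetT _ _).
by apply: Idown Ib _ => //; exact: stone_le.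
Qed.

(** The elements of [I] below [U] form an ideal [J]. It is simple: for [a] in
    [I] the compact set [stone a `&` U] lies in a single [stone b] contained in
    [U], and splitting [a] along [b] decomposes it over [J] and its
    pseudocomplement. The join [s] of [J] represents [U]: it is above [U] as
    [U] is the union of the [stone b] for [b] in [J], and it misses every basic
    set [stone c] disjoint from [U], as then [~` c] bounds [J]. *)
Lemma stone_surj (U : CO Spec) : exists a, stone_CO a = U.
Proof.
have [_ I0 Idown IU] := lba_idealP A.
have [oU cU] := clopen_val U.
pose J : set A := [set a | I a /\ stone I a `<=` val U].
have idJ : ideal_of I J.
  split=> [a []//||a b Ia [Ib bU] ab|a b [Ia aU] [Ib bU]].
  - by split; rewrite ?stone0.
  - by split=> //; apply: subset_trans bU; exact: stoneS.
  - by split; [exact: IU|rewrite stoneU => p [/aU|/bU]].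
have sJ : simple_ideal I J.
  split=> //; apply/seteqP; split=> a.
    by apply; [split|case: idJ|move=> b []].
  move=> Ia M [MI M0 Mdown MU] JM nJM.
  have ca : compact (stone I a) by exact: compact_stone.
  have [b Ib [abU bU]] := @stone_cover (stone I a `&` val U)%classic (val U)
    (compact_closedI ca cU) oU (@subIsetr _ _ _).
  have abE : a = (a `&` b) `|` (a `&` ~` b) by rewrite -meetUr joinxC meetx1.
  rewrite abE; apply: MU.
    apply: JM; split; first exact: Idown (leIl _ _).
    by apply: subset_trans bU; apply: stoneS; exact: leIr.
  apply: nJM; split; first exact: Idown (leIl _ _).
  move=> c [Ic cU']; apply/eqP; apply: contraT => /stone_neq0[p].
  rewrite !stoneI stoneC => -[[pa npb] pc]; case: npb; apply: abU.
  by split=> //; exact: cU'.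
have [s [ubs lbs]] := zlba_joins sJ.
exists s; apply: val_inj => /=; apply/seteqP; split=> p ps; last first.
  have [c pc cU'] := oU p ps; have [_ [b Ib pb]] := svalP p.
  have Jbc : J (b `&` c).
    split; first exact: Idown (leIl _ _).
    by rewrite stoneI => q [_ /cU'].
  by apply: (stoneS (ubs _ Jbc)); rewrite stoneI.
apply: contrapT => nUp.
have oUC : open (~` val U)%classic by exact: closed_openC.
have [c pc cU'] := oUC p nUp.
have /lbs sc : ubound J (~` c).
  move=> b [Ib bU]; apply: stone_le; rewrite stoneC => q /bU Uq /cU'; exact.
by have := stoneS sc ps; rewrite stoneC; exact.
Qed.

Lemma stone_CO_boolean_hom : boolean_hom stone_CO.
Proof.
split=> [a b|a b|a||]; apply: val_inj; rewrite /=.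
- exact: stoneI.
- exact: stoneU.
- exact: stoneC.
- exact: stone0.
- exact: stone1.
Qed.

End StoneRepresentation.

Lemma boolean_hom_le d d' (A : ctbDistrLatticeType d)
    (B : ctbDistrLatticeType d') (phi : A -> B) :
  boolean_hom phi -> {homo phi : a b / a <= b}.
Proof. by case=> phiI _ _ _ _ a b /meet_idPl <-; rewrite phiI leIr. Qed.

(** The inverse of an order isomorphism is its lower adjoint. *)
Lemma opzlba_morphism_bijective (A B : zlba) (phi : A -> B) (psi : B -> A) :
  boolean_hom phi -> cancel phi psi -> cancel psi phi ->
  (forall a, lba_ideal B (phi a) <-> lba_ideal A a) ->
  opzlba_morphism phi /\ opzlba_morphism psi.
Proof.
move=> phiH phiK psiK phiE; have [phiI phiU phiC phi0 phi1] := phiH.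
have psiH : boolean_hom psi.
  split=> [a b|a b|a||]; apply: (can_inj phiK).
  - by rewrite phiI !psiK.
  - by rewrite phiU !psiK.
  - by rewrite phiC !psiK.
  - by rewrite psiK phi0.
  - by rewrite psiK phi1.
have phi_le := boolean_hom_le phiH; have psi_le := boolean_hom_le psiH.
split; split.
- split=> // b Jb; exists (psi b); rewrite ?psiK //.
  by apply/phiE; rewrite psiK.
- by move=> _ [a Ia <-]; exact/phiE.
- exists psi; split=> // a b.
  by split=> [/psi_le|/phi_le]; rewrite ?phiK ?psiK.
- by split=> // a Ia; exists (phi a); rewrite ?phiK //; exact/phiE.
- by move=> _ [b Jb <-]; apply/phiE; rewrite psiK.
- exists phi; split=> // a b.
  by split=> [/phi_le|/psi_le]; rewrite ?phiK ?psiK.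
Qed.

Lemma CO_functor_essentially_surjective (A : opposite OPZLBA) :
  exists (X : OPZLC) (e : hom (CO_functor X) A), isomorphism e.
Proof.
exists (Spec A).
have injs : injective (@stone_CO A).
  move=> a b /(congr1 val)/= ab.
  by apply/eqP; rewrite eq_le; apply/andP; split; apply: stone_le; rewrite ab.
pose psi (U : CO (Spec A)) := sval (cid (@stone_surj A U)).
have psiK : cancel psi (@stone_CO A) by move=> U; rewrite /psi; case: cid.
have phiK : cancel (@stone_CO A) psi by move=> a; apply: injs; rewrite psiK.
have [phiP psiP] := opzlba_morphism_bijective (stone_CO_boolean_hom A) phiK psiK
  (@compact_stoneE A).
exists (exist _ _ phiP), (exist _ _ psiP).
by split; apply: eq_exist; apply/funext => x /=; rewrite ?phiK ?psiK.
Qed.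

(** * The duality *)

Theorem theorem2p11 :
  (forall (X Y : topologicalType) (f : X -> Y) (fP : perfect_map f),
     zlc_space X -> zlc_space Y ->
     (open_map f <-> has_lower_adjoint (Theta fP))) /\
  dually_equivalent OPZLC OPZLBA.
Proof.
split=> [X Y f fP [zX _ _] [zY _ _]|].
  by split; [exact: open_map_lower_adjoint|exact: lower_adjoint_open_map].
apply: (@fully_faithful_esssurj_equivalent _ _ CO_functor).
- exact: CO_functor_faithful.
- exact: CO_functor_full.
- exact: CO_functor_essentially_surjective.
Qed.
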